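(* Let $X$ and $Y$ be graphs. Then the following hold: (i) $\mathrm{LSur}(X,Y)\subseteq\mathrm{LS}(X,Y)$; (ii) $\mathrm{LS}(X,Y)\cap\mathrm{Sur}(X,Y)=\mathrm{LSur}(X,Y)\cap\mathrm{Sur}(X,Y)$.
   Context: All graphs are finite, undirected, simple and reflexive: a graph $X=(V_X,E_X)$ has a finite nonempty vertex set $V_X$, and $E_X$ consists of all loops $\{x\}$ ($x\in V_X$; written $\{x,x\}$) together with a (possibly empty) set of $2$-element subsets of $V_X$. A homomorphism $\varphi:X\to Y$ is a map $\varphi:V_X\to V_Y$ such that $\{x_1,x_2\}\in E_X$ implies $\{\varphi(x_1),\varphi(x_2)\}\in E_Y$. $N_X(x)=\{u\in V_X:\{x,u\}\in E_X\}$ (so $x\in N_X(x)$). $\mathrm{Sur}(X,Y)$ is the set of homomorphisms $X\to Y$ that are surjective on vertices. $\mathrm{LSur}(X,Y)$ is the set of locally surjective homomorphisms, i.e. those with $\varphi(N_X(x))=N_Y(\varphi(x))$ for all $x\in V_X$. $\mathrm{LS}(X,Y)$ is the set of locally strong homomorphisms, i.e. those such that for all $x_1,x_2\in V_X$, $\{\varphi(x_1),\varphi(x_2)\}\in E_Y$ implies that for every $\tilde x_1\in\varphi^{-1}(\varphi(x_1))$ there exists $\tilde x_2\in\varphi^{-1}(\varphi(x_2))$ with $\{\tilde x_1,\tilde x_2\}\in E_X$. *)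

(* Defs.v *)
From mathcomp Require Import all_boot.

Set Implicit Arguments.
Unset Strict Implicit.
Unset Printing Implicit Defensive.

(* Edges {x, y} are encoded by a symmetric relation; reflexivity says that
   every loop {x} is an edge. *)
Record graph := Graph {
  vertex :> finType;
  edge : rel vertex;
  edge_sym : symmetric edge;
  edge_refl : reflexive edge;
  vertex_gt0 : 0 < #|vertex|
}.

Definition nbhd (X : graph) (x : X) : {set X} := [set u | edge x u].

Definition Hom (X Y : graph) : {set {ffun X -> Y}} :=
  [set f : {ffun X -> Y} |
    [forall x1 : X, forall x2 : X, edge x1 x2 ==> edge (f x1) (f x2)]].

Definition Sur (X Y : graph) : {set {ffun X -> Y}} :=
  [set f in Hom X Y | f @: [set: X] == [set: Y]].

Definition LSur (X Y : graph) : {set {ffun X -> Y}} :=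
  [set f in Hom X Y | [forall x : X, f @: nbhd x == nbhd (f x)]].

Definition LS (X Y : graph) : {set {ffun X -> Y}} :=
  [set f in Hom X Y |
    [forall x1 : X, forall x2 : X, edge (f x1) (f x2) ==>
      [forall t1 in f @^-1: [set f x1],
        exists t2 in f @^-1: [set f x2], edge t1 t2]]].

(* Main.v *)
Require Import Defs.
From mathcomp Require Import all_boot.

(** Local surjectivity lifts every edge of [Y] at [f t] to an edge of [X] at [t]; [LS] asks for such
    lifts only when both ends of the edge lie in the image of [f]. The two conditions agree once
    every vertex of [Y] has a preimage. *)

Lemma LSur_sub_LS (X Y : graph) : LSur X Y \subset LS X Y.
Proof.
apply/subsetP => f; rewrite !inE => /andP[-> /forallP lsurf] /=.
apply/forallP => x1; apply/forallP => x2; apply/implyP => e12.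
apply/forall_inP => t1; rewrite !inE => /eqP ft1.
(* Local surjectivity is applied at [t1], not [x1]: the lifted edge must start at [t1]. *)
have : f x2 \in f @: nbhd t1 by rewrite (eqP (lsurf t1)) inE ft1.
case/imsetP => t2; rewrite inE => et12 ft2.
by apply/exists_inP; exists t2; rewrite // !inE ft2.
Qed.

Lemma LS_Sur_sub_LSur (X Y : graph) : LS X Y :&: Sur X Y \subset LSur X Y.
Proof.
apply/subsetP => f; rewrite !inE => /andP[/andP[homf /forallP lsf]].
case/andP=> _ /eqP surf; rewrite homf /=.
apply/forallP => x; rewrite eqEsubset; apply/andP; split; apply/subsetP => y.
  case/imsetP => u; rewrite !inE => exu ->.
  exact: (implyP (forallP (forallP homf x) u)).
rewrite inE => exy.
(* Surjectivity gives [y] the form [f u], so that [LS] applies to the pair [x], [u], with [x] itself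
   taken in its fibre. *)
have : y \in f @: [set: X] by rewrite surf inE.
case/imsetP => u _ yE; rewrite {}yE in exy *.
have /forall_inP/(_ x) := implyP (forallP (lsf x) u) exy.
rewrite !inE eqxx => /(_ isT)/exists_inP[t]; rewrite !inE => /eqP <- ext.
by apply: imset_f; rewrite inE.
Qed.

Theorem lemma5p6 (X Y : graph) :
  LSur X Y \subset LS X Y /\
  LS X Y :&: Sur X Y = LSur X Y :&: Sur X Y.
Proof.
split; first exact: LSur_sub_LS.
apply/eqP; rewrite eqEsubset subsetI LS_Sur_sub_LSur subsetIr /=.
by rewrite setSI // LSur_sub_LS.
Qed.
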